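(* Let $(M,d)$ be a compact metric space and let $f\colon M\to M$ be a homeomorphism. Then $f$ is cohomologically $C^0$-stable if and only if $f$ is periodic, i.e. $f$ has finite order in the group of homeomorphisms of $M$.
   Context: $C^0(M)$ denotes the space of real-valued continuous functions on $M$, endowed with the uniform norm $\|\phi\|_{C^0}:=\sup_{x\in M}|\phi(x)|$. For a homeomorphism $f\colon M\to M$, the space of $C^0$-coboundaries is $B(f,C^0(M)):=\{v\circ f-v : v\in C^0(M)\}$. The homeomorphism $f$ is said to be cohomologically $C^0$-stable if $B(f,C^0(M))$ is a closed subset of $C^0(M)$. The homeomorphism $f$ is said to be periodic if there exists an integer $q\geq 1$ with $f^q=\mathrm{id}_M$. *)

(* Defs.v *)
From HB Require Import structures.
From mathcomp Require Import all_boot all_order all_algebra.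
From mathcomp Require Import all_classical all_reals topology normedtype.

Set Implicit Arguments.
Unset Strict Implicit.
Unset Printing Implicit Defensive.

Import Order.TTheory GRing.Theory Num.Theory.
Import numFieldNormedType.Exports.

Local Open Scope classical_set_scope.
Local Open Scope ring_scope.

Definition homeomorphism (X Y : topologicalType) (f : X -> Y) : Prop :=
  continuous f /\ exists g : Y -> X, [/\ continuous g, cancel f g & cancel g f].

Definition periodic (X : Type) (f : X -> X) : Prop :=
  exists q : nat, (1 <= q)%N /\ iter q f =1 id.

(* The compactness proof is a parameter of the type so that the supremum norm,
   which is only a norm on bounded functions, can be attached to it. *)
Definition C0 (R : realType) (M : metricType R) (cM : compact [set: M]) : Type :=
  continuousType M R.

Section C0_normed.
Context {R : realType} {M : metricType R} {cM : compact [set: M]}.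
Local Notation C0M := (C0 cM).

HB.instance Definition _ := Choice.copy C0M (continuousType M R).

Definition C0_fun (phi : C0M) : M -> R := phi : continuousType M R.
Local Coercion C0_fun : C0 >-> Funclass.

Definition C0_mk (u : M -> R) (cu : continuous u) : C0M :=
  HB.pack_for (continuousType M R) u (@isContinuous.Build M R u cu).

Lemma C0_mkE (u : M -> R) (cu : continuous u) x : C0_mk cu x = u x.
Proof. by []. Qed.

Lemma C0_continuous (phi : C0M) : continuous phi.
Proof. exact: (@cts_fun M R phi). Qed.

Lemma C0P (phi psi : C0M) : phi =1 psi -> phi = psi.
Proof. by move=> e; apply/(@continuousEP M R phi psi). Qed.

Lemma C0_zero_continuous : continuous ((fun=> 0) : M -> R).
Proof. by move=> x; exact: cvg_cst. Qed.

Lemma C0_add_continuous (phi psi : C0M) : continuous (fun x => phi x + psi x).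
Proof. by move=> x; apply: cvgD; exact: C0_continuous. Qed.

Lemma C0_opp_continuous (phi : C0M) : continuous (fun x => - phi x).
Proof. by move=> x; apply: cvgN; exact: C0_continuous. Qed.

Lemma C0_scale_continuous (a : R) (phi : C0M) : continuous (fun x => a * phi x).
Proof. by move=> x; apply: cvgM; [exact: cvg_cst|exact: C0_continuous]. Qed.

Definition C0_zero : C0M := C0_mk C0_zero_continuous.
Definition C0_add (phi psi : C0M) : C0M := C0_mk (@C0_add_continuous phi psi).
Definition C0_opp (phi : C0M) : C0M := C0_mk (@C0_opp_continuous phi).
Definition C0_scale (a : R) (phi : C0M) : C0M :=
  C0_mk (@C0_scale_continuous a phi).

Fact C0_addA : associative C0_add.
Proof. by move=> u v w; apply: C0P => x; exact: addrA. Qed.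
Fact C0_addC : commutative C0_add.
Proof. by move=> u v; apply: C0P => x; exact: addrC. Qed.
Fact C0_add0 : left_id C0_zero C0_add.
Proof. by move=> u; apply: C0P => x; exact: add0r. Qed.
Fact C0_addN : left_inverse C0_zero C0_opp C0_add.
Proof. by move=> u; apply: C0P => x; exact: addNr. Qed.

HB.instance Definition _ :=
  GRing.isZmodule.Build C0M C0_addA C0_addC C0_add0 C0_addN.

Fact C0_scaleA a b (u : C0M) : C0_scale a (C0_scale b u) = C0_scale (a * b) u.
Proof. by apply: C0P => x; exact: mulrA. Qed.
Fact C0_scale1 : left_id 1 C0_scale.
Proof. by move=> u; apply: C0P => x; exact: mul1r. Qed.
Fact C0_scaleDr : right_distributive C0_scale +%R.
Proof. by move=> a u v; apply: C0P => x; exact: mulrDr. Qed.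
Fact C0_scaleDl (u : C0M) : {morph C0_scale^~ u : a b / a + b}.
Proof. by move=> a b; apply: C0P => x; exact: mulrDl. Qed.

HB.instance Definition _ := GRing.Zmodule_isLmodule.Build R C0M
  C0_scaleA C0_scale1 C0_scaleDr C0_scaleDl.

Definition C0_norm (phi : C0M) : R := sup [set `|phi x| | x in [set: M]].

Lemma C0_norm_ub (phi : C0M) x : `|phi x| <= C0_norm phi.
Proof.
have cphi : compact (phi @` [set: M]).
  apply: continuous_compact cM.
  by apply: continuous_subspaceT; exact: C0_continuous.
have [K [_ KP]] := compact_bounded cphi.
apply: ub_le_sup; last by exists x.
exists (K + 1) => _ [y _ <-].
by apply: (KP (K + 1)); [rewrite ltrDl|exists y].
Qed.

Lemma C0_norm_le (phi : C0M) (c : R) :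
  0 <= c -> (forall x, `|phi x| <= c) -> C0_norm phi <= c.
Proof.
move=> c0 le_c; have [[x _]|/forallNP/= noM] := pselect (exists x : M, True).
  apply: ge_sup; first by exists `|phi x|, x.
  by move=> _ [y _ <-].
rewrite /C0_norm (_ : [set _ | _ in _] = set0) ?sup0//.
by rewrite -subset0 => y [x _ _]; exact: (noM x).
Qed.

Lemma C0_norm_ge0 (phi : C0M) : 0 <= C0_norm phi.
Proof.
have [[x _]|/forallNP/= noM] := pselect (exists x : M, True).
  exact: le_trans (normr_ge0 _) (C0_norm_ub phi x).
rewrite /C0_norm (_ : [set _ | _ in _] = set0) ?sup0//.
by rewrite -subset0 => y [x _ _]; exact: (noM x).
Qed.

Fact C0_ler_normD (u v : C0M) : C0_norm (u + v) <= C0_norm u + C0_norm v.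
Proof.
apply: C0_norm_le => [|x]; first by rewrite addr_ge0 ?C0_norm_ge0.
exact: le_trans (ler_normD _ _) (lerD (C0_norm_ub _ _) (C0_norm_ub _ _)).
Qed.

Fact C0_normrZ (a : R) (u : C0M) : C0_norm (a *: u) = `|a| * C0_norm u.
Proof.
have le_scale b (w : C0M) : C0_norm (b *: w) <= `|b| * C0_norm w.
  apply: C0_norm_le => [|x]; first by rewrite mulr_ge0 ?C0_norm_ge0.
  rewrite [X in `|X|](_ : _ = b * w x)// normrM.
  by rewrite ler_wpM2l// C0_norm_ub.
apply/eqP; rewrite eq_le le_scale/=.
have [->|a0] := eqVneq a 0; first by rewrite normr0 mul0r C0_norm_ge0.
rewrite -ler_pdivlMl ?normr_gt0// -normfV.
by have := le_scale a^-1 (a *: u); rewrite scalerA mulVf// scale1r.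
Qed.

Fact C0_normr0_eq0 (u : C0M) : C0_norm u = 0 -> u = 0.
Proof.
move=> u0; apply: C0P => x; apply/eqP; rewrite -normr_le0 -u0.
exact: C0_norm_ub.
Qed.

HB.instance Definition _ := Lmodule_isNormed.Build R C0M
  C0_ler_normD C0_normrZ C0_normr0_eq0.

End C0_normed.

Coercion C0_fun : C0 >-> Funclass.

Section C0_normed_theory.
Context {R : realType} {M : metricType R} {cM : compact [set: M]}.
Implicit Types phi psi : C0 cM.

Lemma C0_normE phi : `|phi| = sup [set `|phi x| | x in [set: M]].
Proof. by []. Qed.

Lemma C0_addE phi psi x : (phi + psi) x = phi x + psi x.
Proof. by []. Qed.

Lemma C0_oppE phi x : (- phi) x = - phi x.
Proof. by []. Qed.

Lemma C0_scaleE (a : R) phi x : (a *: phi) x = a * phi x.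
Proof. by []. Qed.

End C0_normed_theory.

Definition C0_coboundaries (R : realType) (M : metricType R)
    (cM : compact [set: M]) (f : M -> M) : set (C0 cM) :=
  [set phi : C0 cM | exists v : C0 cM, phi =1 (v \o f) \- v].

Arguments C0_coboundaries {R M} cM f _.

Definition cohomologically_C0_stable (R : realType) (M : metricType R)
    (cM : compact [set: M]) (f : M -> M) : Prop :=
  closed (C0_coboundaries cM f).

(* Main.v *)
(* Coboundaries v \o f - v have bounded Birkhoff sums, as these telescope.
   If f^q = id, the coboundaries are exactly the phi whose Birkhoff sums of
   length q vanish, a closed condition: the solution is
   v = - (1 / q) \sum_(j < q) S_j phi.
   If f is not periodic, there are arbitrarily long injective orbit segments,
   along which a tent function gives v with |v \o f - v| <= 1 and v rising by N
   in N steps; rescaling yields arbitrarily small coboundaries with arbitrarily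
   large Birkhoff sums.  A gliding-hump construction (uniform boundedness) then
   produces a limit of coboundaries whose Birkhoff sums are unbounded. *)
Require Import Defs.
From mathcomp Require Import all_boot all_order all_algebra.
From mathcomp Require Import all_classical all_reals topology normedtype.
From mathcomp Require Import zify ring lra.

Set Implicit Arguments.
Unset Strict Implicit.
Unset Printing Implicit Defensive.

Import Order.TTheory GRing.Theory Num.Theory.
Import numFieldNormedType.Exports.

Local Open Scope classical_set_scope.
Local Open Scope ring_scope.

(** * Birkhoff sums and return times *)

Definition birkhoff_sum (M : Type) (V : nmodType) (f : M -> M) (n : nat)
    (phi : M -> V) (x : M) : V :=
  \sum_(i < n) phi (iter i f x).

Lemma birkhoff_sum_coboundary (M : Type) (V : zmodType) (f : M -> M) (n : nat)
    (phi v : M -> V) (x : M) :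
  phi =1 (v \o f) \- v -> birkhoff_sum f n phi x = v (iter n f x) - v x.
Proof.
move=> phiE; rewrite /birkhoff_sum; elim: n => [|n IH].
  by rewrite big_ord0 subrr.
by rewrite big_ord_recr/= IH phiE/= addrC subrKA.
Qed.

Lemma birkhoff_sum_shift (M : Type) (V : zmodType) (f : M -> M) (n : nat)
    (phi : M -> V) (x : M) :
  birkhoff_sum f n phi (f x) = birkhoff_sum f n.+1 phi x - phi x.
Proof.
rewrite /birkhoff_sum big_ord_recl/= addrC addrA addNr add0r.
by apply: eq_bigr => i _; rewrite -iterS iterSr.
Qed.

Lemma cancel_iter (T : Type) (f g : T -> T) (n : nat) :
  cancel f g -> cancel (iter n f) (iter n g).
Proof. by move=> fK x; elim: n => // n IH; rewrite iterSr /= fK. Qed.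

Lemma periodic_cancel (T : Type) (f g : T -> T) :
  cancel g f -> periodic g -> periodic f.
Proof.
move=> gK [q [q1 gq]]; exists q; split => // x.
by rewrite -[in LHS](gq x) (cancel_iter _ gK).
Qed.

Lemma iter_fix_dvd (T : Type) (f : T -> T) (m n : nat) (x : T) :
  (m %| n)%N -> iter m f x = x -> iter n f x = x.
Proof.
by move=> /dvdnP[k ->] fx; elim: k => //= k IH; rewrite mulSn iterD IH.
Qed.

(** If every point returned to itself at some time between 1 and [n], then [n!] would be a common
    period. *)
Lemma not_periodic_orbit (T : Type) (f : T -> T) (n : nat) : ~ periodic f ->
  exists x, forall i, (0 < i <= n)%N -> iter i f x <> x.
Proof.
move=> nper; apply: contrapT => /forallNP noorb; apply: nper.
exists n`!; split; first exact: fact_gt0.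
move=> x; have /existsNP[i /not_implyP[i0n /contrapT fix_i]] := noorb x.
exact: iter_fix_dvd (dvdn_fact i0n) fix_i.
Qed.

(** * Bump functions, continuity and nested balls *)

Section metric_bump.
Context {R : realType} {M : metricType R}.

Lemma mdist_continuous (x : M) : continuous (mdist x : M -> R).
Proof.
move=> y; apply/cvgrPdist_lt => e e0.
apply: filterS (nbhsx_ballx y e e0) => z; rewrite ballEmdist/=.
apply: le_lt_trans; rewrite ler_distlC.
have := metric_triangle x y z; have := metric_triangle x z y.
by rewrite (metric_sym z y) => *; lra.
Qed.

Lemma bump_at (x : M) (n : nat) (u : nat -> M) :
  (forall i, (i < n)%N -> u i <> x) ->
  exists phi : M -> R, [/\ continuous phi, forall y, 0 <= phi y <= 1,
    phi x = 1 & forall i, (i < n)%N -> phi (u i) = 0].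
Proof.
(* The radius is the distance from [x] to the nearest [u i], capped at 1 so that [n = 0] is
   allowed. *)
move=> ux; pose e : R := \big[Num.min/1]_(i < n) mdist x (u i).
have e0 : 0 < e.
  apply: lt_bigmin => // i _; rewrite mdist_gt0.
  by apply/eqP => /esym; exact: ux.
exists (fun y => Num.max 0 (1 - mdist x y / e)); split.
- move=> y; apply: (@continuous_max _ _ (cst 0) (fun y => 1 - mdist x y / e)).
    exact: cvg_cst.
  apply: cvgB; first exact: cvg_cst.
  by apply: cvgM; [exact: mdist_continuous|exact: cvg_cst].
- move=> y; rewrite le_max lexx/= ge_max ler01/=.
  by rewrite lerBlDr lerDl divr_ge0 ?mdist_ge0// ltW.
- by rewrite mdistxx mul0r subr0; apply/max_idPr.
- move=> i ni; apply/max_idPl; rewrite subr_le0 ler_pdivlMr// mul1r.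
  exact: (bigmin_le _ (Ordinal ni)).
Qed.

End metric_bump.

Lemma bigmax_continuous (R : realType) (T : topologicalType) (n : nat)
    (F : nat -> T -> R) :
  (forall i, continuous (F i)) ->
  continuous (fun y => \big[Num.max/0]_(i < n) F i y).
Proof.
move=> cF; apply: continuous_big => [|i _]; last exact: cF.
exact: max_continuous.
Qed.

Lemma iter_continuous (T : topologicalType) (f : T -> T) (n : nat) :
  continuous f -> continuous (iter n f).
Proof.
move=> cf; elim: n => [|n IH] x; first exact: cvg_id.
by apply: (@continuous_comp _ _ _ (iter n f) f); [exact: IH|exact: cf].
Qed.

(* The limit is the pointwise supremum of the lower bounds [u k - r k];
   nestedness makes every [u k + r k] an upper bound of them. *)
Lemma C0_nested_balls (R : realType) (M : metricType R)
    (cM : compact [set: M]) (u : nat -> C0 cM) (r : nat -> R) :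
  (forall k, 0 < r k) -> (forall k, `|u k.+1 - u k| + r k.+1 <= r k) ->
  (forall e, 0 < e -> exists k, r k < e) ->
  exists phi : C0 cM, forall k, `|phi - u k| <= r k.
Proof.
move=> rpos nest r0.
have nest_le j k : (j <= k)%N -> `|u k - u j| + r k <= r j.
  elim: k => [|k IH].
    by rewrite leqn0 => /eqP ->; rewrite subrr normr0 add0r.
  rewrite leq_eqVlt => /predU1P[->|]; first by rewrite subrr normr0 add0r.
  rewrite ltnS => /IH; have := nest k.
  by have := ler_distD (u k) (u k.+1) (u j) => *; lra.
have dist_le j k : `|u k - u j| <= r j + r k.
  case: (leqP j k) => [/nest_le|/ltnW/nest_le].
    by have := rpos k => *; lra.
  by rewrite distrC; have := rpos j => *; lra.
pose lo x := [set u k x - r k | k in [set: nat]].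
have lo_ub x j : ubound (lo x) (u j x + r j).
  move=> _ [k _ <-]; have := le_trans (C0_norm_ub (u k - u j) x) (dist_le j k).
  by rewrite ler_norml /= => /andP[_ ?]; lra.
have sup_dist x k : `|sup (lo x) - u k x| <= r k.
  have : sup (lo x) <= u k x + r k.
    by apply: ge_sup (lo_ub x k); exists (u 0 x - r 0), 0.
  rewrite ler_distl => ->; rewrite andbT.
  by apply: ub_le_sup; [exists (u 0 x + r 0); exact: lo_ub|exists k].
have cphi : continuous (fun x => sup (lo x)).
  move=> x; apply/cvgrPdist_lt => e e0.
  (* An [e / 3] argument: [u k] is within [r k] of the supremum at both points. *)
  have [k rk] := r0 _ (divr_gt0 e0 (ltr0Sn _ 2)).
  have := @C0_continuous R M cM (u k) x.
  move=> /cvgrPdist_lt/(_ _ (divr_gt0 e0 (ltr0Sn _ 2))).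
  apply: filterS => y.
  have := sup_dist x k; have := sup_dist y k.
  rewrite !ler_norml !ltr_norml => /andP[? ?] /andP[? ?] /andP[? ?].
  by apply/andP; split; lra.
exists (C0_mk cphi) => k; apply: C0_norm_le; first exact: ltW.
by move=> x; exact: sup_dist.
Qed.

(** * Gliding hump for coboundaries *)

Section coboundaries.
Context {R : realType} {M : metricType R} {cM : compact [set: M]} (f : M -> M).
Local Notation S := (birkhoff_sum f).
Local Notation B := (C0_coboundaries cM f).
Implicit Types phi psi : C0 cM.

Lemma birkhoff_sumD n phi psi x : S n (phi + psi) x = S n phi x + S n psi x.
Proof. by rewrite /birkhoff_sum -big_split. Qed.

Lemma birkhoff_sumB n phi psi x : S n (phi - psi) x = S n phi x - S n psi x.
Proof. by rewrite /birkhoff_sum -sumrB. Qed.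

(** This Lipschitz bound makes large sums persist under small perturbations and vanishing sums pass
    to limits. *)
Lemma birkhoff_sum_le n phi x : `|S n phi x| <= n%:R * `|phi|.
Proof.
apply: le_trans (ler_norm_sum _ _ _) _.
rewrite mulr_natl -[in leRHS](card_ord n) -sumr_const ler_sum// => i _.
exact: C0_norm_ub.
Qed.

Lemma coboundaryD phi psi : B phi -> B psi -> B (phi + psi).
Proof.
move=> [v phiE] [w psiE]; exists (v + w) => x.
by rewrite /= phiE psiE/=; ring.
Qed.

Lemma coboundaryZ (a : R) phi : B phi -> B (a *: phi).
Proof.
move=> [v phiE]; exists (a *: v) => x.
by rewrite /= phiE/=; ring.
Qed.

Lemma coboundary_birkhoff_bounded phi : B phi ->
  exists K, forall n x, `|S n phi x| <= K.
Proof.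
move=> [v phiE]; exists (`|v| + `|v|) => n x.
rewrite (birkhoff_sum_coboundary _ _ phiE).
by apply: le_trans (ler_normB _ _) _; rewrite lerD// C0_norm_ub.
Qed.

(** What the gliding hump needs from non-periodicity: scaling [v] by [r] gives a coboundary of norm
    at most [r] whose [N]-step sum at [x] is at least [r * N]. *)
Definition slow_climbs : Prop := forall N : nat, exists (v : C0 cM) x,
  [/\ forall y, `|v (f y) - v y| <= 1, v x = 0 & N%:R <= v (iter N f x)].

Lemma small_coboundary_large_sum (r K : R) :
  continuous f -> slow_climbs -> 0 < r ->
  exists psi n x, [/\ B psi, `|psi| <= r & K < S n psi x].
Proof.
move=> cf climb r0; pose N := Num.bound `|K / r|.
have [v [x [v1 vx0 vN]]] := climb N.
have cvf : continuous (v \o f).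
  by move=> y; apply: continuous_comp; [exact: cf|exact: C0_continuous].
pose psi := r *: (C0_mk cvf - v).
have Bpsi : B psi by apply: coboundaryZ; exists v.
exists psi, N, x; split => //.
  apply: C0_norm_le => [|y]; first exact: ltW.
  by rewrite /psi/= normrM gtr0_norm// ler_piMr ?v1// ltW.
have psiE : psi =1 ((r *: v) \o f) \- (r *: v).
  by move=> y; rewrite /=; ring.
rewrite (birkhoff_sum_coboundary _ _ psiE)/= vx0 mulr0 subr0.
apply: lt_le_trans (ler_wpM2l (ltW r0) vN).
rewrite mulrC -ltr_pdivrMr//; apply: le_lt_trans (ler_norm _) _.
exact: archi_boundP (normr_ge0 _).
Qed.

Lemma perturb_large_sum (r K : R) phi :
  continuous f -> slow_climbs -> 0 < r -> B phi ->
  exists psi n x, [/\ B psi, `|psi - phi| <= r & K < `|S n psi x|].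
Proof.
(* A sum above [2 K] stays above [K] after adding a sum of [phi] of modulus at most [K]. *)
move=> cf climb r0 Bphi; have [psi [n [x [Bpsi psir KS]]]] :=
  small_coboundary_large_sum (K *+ 2) cf climb r0.
have [Kphi|phiK] := ltP K `|S n phi x|.
  by exists phi, n, x; split => //; rewrite subrr normr0 ltW.
exists (phi + psi), n, x; split; first exact: coboundaryD.
  by rewrite addrAC subrr add0r.
rewrite birkhoff_sumD; move: phiK; rewrite ler_norml => /andP[? ?].
by apply: lt_le_trans (ler_norm _); lra.
Qed.

Lemma gliding_step (k : nat) (r : R) phi :
  continuous f -> slow_climbs -> 0 < r -> B phi ->
  exists psi r', [/\ B psi, 0 < r', r' <= k.+1%:R^-1, `|psi - phi| + r' <= r &
    forall chi : C0 cM, `|chi - psi| <= r' -> exists n x, k%:R < `|S n chi x|].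
Proof.
move=> cf climb r0 Bphi; have r20 : 0 < r / 2 by rewrite divr_gt0.
have [psi [n [x [Bpsi psir KS]]]] :=
  perturb_large_sum k%:R cf climb r20 Bphi.
pose d := `|S n psi x| - k%:R.
have d0 : 0 < d by rewrite subr_gt0.
(* The three bounds keep the new ball inside the old one, force the radii to 0, and keep the change
   of the sum below [d]; [n.+1] avoids dividing by 0. *)
exists psi, (Num.min (r / 2) (Num.min k.+1%:R^-1 (d / n.+1%:R))); split => //.
- by rewrite !lt_min r20 invr_gt0 ltr0Sn divr_gt0.
- by rewrite !ge_min lexx !orbT.
- by rewrite [leRHS](splitr r) lerD// ge_min lexx.
move=> chi; rewrite !le_min => /and3P[_ _ chi_near]; exists n, x.
have : `|S n (chi - psi) x| < d.
  apply: le_lt_trans (birkhoff_sum_le _ _ _) _.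
  apply: le_lt_trans (ler_wpM2l (ler0n _ _) chi_near) _.
  by rewrite mulrA ltr_pdivrMr// mulrC ltr_pM2l// ltr_nat.
rewrite birkhoff_sumB /d => ?.
have := ler_distD (S n chi x) (S n psi x) 0.
by rewrite !subr0 distrC => ?; lra.
Qed.

Lemma coboundaries_not_closed : continuous f -> slow_climbs -> ~ closed B.
Proof.
move=> cf climb clB.
(* Choice needs a total function, so pairs violating the invariant are returned unchanged. *)
have /choice[F FP] (ks : nat * (C0 cM * R)) : exists s : C0 cM * R,
    0 < ks.2.2 -> B ks.2.1 -> [/\ B s.1, 0 < s.2, s.2 <= ks.1.+1%:R^-1,
      `|s.1 - ks.2.1| + s.2 <= ks.2.2 &
      forall chi : C0 cM, `|chi - s.1| <= s.2 ->
        exists n x, ks.1%:R < `|S n chi x|].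
  case: ks => k [phi r] /=.
  have [[r0 Bphi]|nP] := pselect (0 < r /\ B phi).
    by have [psi [r' ?]] := gliding_step k cf climb r0 Bphi; exists (psi, r').
  by exists (phi, r) => r0 Bphi; case: nP.
pose s := fix s k := if k is j.+1 then F (j, s j) else (0 : C0 cM, 1 : R).
have s_inv k : B (s k).1 /\ 0 < (s k).2.
  elim: k => [|k [Bk rk]] /=; last by have [] := FP (k, s k) rk Bk.
  by split; [exists 0 => x; rewrite /= subrr|exact: ltr01].
have step k := FP (k, s k) (s_inv k).2 (s_inv k).1.
have r_small e : 0 < e -> exists k, (s k).2 < e.
  move=> e0; pose k := Num.bound e^-1; exists k.+1.
  have [_ _ /le_lt_trans + _ _] := step k; apply.
  rewrite invf_plt ?posrE// (@lt_trans _ _ k%:R) ?ltr_nat//.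
  by apply: archi_boundP; rewrite invr_ge0 ltW.
have [phi phi_near] : exists phi : C0 cM, forall k, `|phi - (s k).1| <= (s k).2.
  apply: C0_nested_balls => // k; first exact: (s_inv k).2.
  by have [] := step k.
have Bphi : B phi.
  apply: clB => A /nbhs_normP[e /= e0 eA]; have [k rk] := r_small e e0.
  exists (s k).1; split; first exact: (s_inv k).1.
  by apply: eA; apply: le_lt_trans rk.
have [K Kphi] := coboundary_birkhoff_bounded Bphi.
(* The limit lies in ball [k.+1], where some sum exceeds [k], hence [K]. *)
pose k := Num.bound `|K|.
have [_ _ _ _ /(_ phi (phi_near k.+1))[n [x]]] := step k.
move=> /lt_le_trans/(_ (Kphi n x)); apply/negP; rewrite -leNgt.
by apply: le_trans (ler_norm _) (ltW (archi_boundP (normr_ge0 _))).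
Qed.

End coboundaries.

(** * Tent functions along long orbit segments *)

Arguments slow_climbs {R M} cM f.

(* The witness is the maximum over [0 <= i <= 2 N] of the tent function
   [min i (2 N - i)] times the bump [phi] moved [i] steps along [f]: composing
   with [f] only shifts [i] by one, which changes each term by at most [1]. *)
Lemma not_periodic_slow_climbs (R : realType) (M : metricType R)
    (cM : compact [set: M]) (f g : M -> M) :
  continuous g -> cancel f g -> cancel g f -> ~ periodic f -> slow_climbs cM f.
Proof.
move=> cg fK gK nperf N; have nperg : ~ periodic g.
  by move=> /(periodic_cancel gK).
have [x xorb] := not_periodic_orbit (2 * N) nperg.
(* The zeros along the [g]-orbit of [x] kill all terms of [v x] with [i > 0]; the term [i = 0] has
   weight 0. *)
have [phi [cphi phi01 phix phi0]] : exists phi : M -> R,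
    [/\ continuous phi, forall y, 0 <= phi y <= 1, phi x = 1 &
      forall i, (i < 2 * N)%N -> phi (iter i.+1 g x) = 0].
  by apply: bump_at => i iN; apply: xorb; lia.
pose a i : R := (minn i (2 * N - i))%:R.
have a_lip i : `|a i.+1 - a i| <= 1.
  rewrite /a ler_distl.
  by apply/andP; split; rewrite ?lerBlDr natr1 ler_nat; lia.
have cF i : continuous (fun y => a i * phi (iter i g y)).
  move=> y; apply: cvgM; first exact: cvg_cst.
  by apply: continuous_comp; [exact: iter_continuous|exact: cphi].
pose v := C0_mk (bigmax_continuous (n := (2 * N).+1) cF) : C0 cM.
have vE y :
  v y = \big[Num.max/0]_(i < (2 * N).+1) (a i * phi (iter i g y)) by [].
have v_ge i y : (i < (2 * N).+1)%N -> a i * phi (iter i g y) <= v y.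
  by move=> iN; rewrite vE (le_bigmax 0 _ (Ordinal iN)).
have v_ge0 y : 0 <= v y by rewrite vE bigmax_ge_id.
have tent i y : `|a i.+1 * phi y - a i * phi y| <= 1.
  rewrite -mulrBl normrM mulr_ile1//.
  by have /andP[? ?] := phi01 y; rewrite ger0_norm.
exists v, x; split.
(* Term [i] at [y] is paired with term [i.+1] at [f y]; the unpaired terms, [2 * N] at [y] and [0]
   at [f y], have weight 0. *)
- move=> y; rewrite ler_distl lerBlDr; apply/andP; split.
    rewrite {1}vE; apply/bigmax_leP; split; first by rewrite addr_ge0.
    move=> i _; have [iN|iN] := ltnP i (2 * N).
      have := v_ge i.+1 (f y) iN; have := tent i (iter i g y).
      by rewrite iterSr fK ler_norml => /andP[? ?] *; lra.
    by rewrite /a (_ : minn i _ = 0%N) ?mul0r ?addr_ge0//; lia.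
  rewrite {1}vE; apply/bigmax_leP; split; first by rewrite addr_ge0.
  case=> -[|i] iN _; rewrite [nat_of_ord _]/=.
    by rewrite /a min0n mul0r addr_ge0.
  have := v_ge i y (ltnW iN); have := tent i (iter i g y).
  by rewrite iterSr fK ler_norml => /andP[? ?] *; lra.
- apply/eqP; rewrite eq_le v_ge0 andbT vE; apply/bigmax_leP; split => //.
  case=> -[|i] iN _ /=; first by rewrite /a min0n mul0r.
  by rewrite -iterS phi0 ?mulr0.
(* The peak term [i = N] sees the bump at [x] itself. *)
have := v_ge N (iter N f x); rewrite (cancel_iter _ fK) phix mulr1 /a.
by rewrite (_ : minn _ _ = N); [apply|]; lia.
Qed.

(** * The periodic case and the equivalence *)

Lemma periodic_coboundariesE (R : realType) (M : metricType R)
    (cM : compact [set: M]) (f : M -> M) (q : nat) :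
  continuous f -> (0 < q)%N -> iter q f =1 id ->
  C0_coboundaries cM f = [set phi | forall x, birkhoff_sum f q phi x = 0].
Proof.
move=> cf q0 fq; apply/seteqP; split => phi /=.
  by move=> [v phiE] x; rewrite (birkhoff_sum_coboundary _ _ phiE) fq subrr.
move=> Sq0.
have cS n : continuous (birkhoff_sum f n phi).
  apply: continuous_big => [|i _]; first exact: add_continuous.
  move=> x; apply: continuous_comp; last exact: C0_continuous.
  exact: iter_continuous.
pose v : M -> R := fun x => - q%:R^-1 * \sum_(j < q) birkhoff_sum f j phi x.
have cv : continuous v.
  move=> x; apply: cvgM; first exact: cvg_cst.
  apply: (@continuous_big _ _ _ _ xpredT) => [|j _]; last exact: cS.
  exact: add_continuous.
exists (C0_mk cv) => x /=; rewrite /v -mulrBr -sumrB.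
(* Each summand becomes [S_(j+1) - S_j - phi] at [x]; the sum telescopes to
   [S_q - S_0 - q phi = - q phi]. *)
under eq_bigr do rewrite birkhoff_sum_shift addrAC.
rewrite sumrB sumr_const card_ord.
rewrite -(big_mkord xpredT
  (fun j => birkhoff_sum f j.+1 phi x - birkhoff_sum f j phi x)).
rewrite telescope_sumr// Sq0 {1}/birkhoff_sum big_ord0 subrr add0r mulrNN.
by rewrite -[phi x *+ q]mulr_natl mulKf// pnatr_eq0 -lt0n.
Qed.

Theorem theoremA (R : realType) (M : metricType R)
    (cM : compact [set: M]%classic) (f : M -> M) (hf : homeomorphism f) :
  cohomologically_C0_stable cM f <-> periodic f.
Proof.
have [cf [g [cg fK gK]]] := hf; split => [clB|[q [q0 fq]]].
  apply: contrapT => nper; apply: coboundaries_not_closed clB => //.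
  exact: not_periodic_slow_climbs cg fK gK nper.
rewrite /cohomologically_C0_stable (periodic_coboundariesE cM cf q0 fq).
move=> phi clphi x; apply/eqP; rewrite -normr_le0; apply/ler_addgt0Pl => e e0.
(* Sums of length [q] amplify the norm by at most [q], hence the radius [e / q]. *)
have [|psi [/= /(_ x) Sq0 psi_near]] :=
    clphi [set psi | `|phi - psi| < e / q%:R].
  by apply/nbhs_normP; exists (e / q%:R) => //=; rewrite divr_gt0 ?ltr0n.
rewrite addr0 -[birkhoff_sum _ _ _ _]subr0 -Sq0 -birkhoff_sumB.
apply: le_trans (birkhoff_sum_le _ _ _ _) _.
by rewrite mulrC -ler_pdivlMr ?ltr0n// ltW.
Qed.
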